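(* Let $\beta>0$ and let $\psi:\mathbb{R}\to[0,\infty]$ be such that $e^{-\psi}$ is a distribution function on $\mathbb{R}$. The limit law, as $n\to\infty$, of the maximum of $n$ i.i.d. G-gamma-MID($\frac{\beta}{n}$) random variables is gamma-MID($\beta$). That is, if for each integer $n\ge1$ the variables $X_{n,1},\ldots,X_{n,n}$ are i.i.d. with distribution function $\dfrac{1}{1+\frac{\beta}{n}\log(1+\psi(x))}$, then the distribution function of $\max(X_{n,1},\ldots,X_{n,n})$ converges, as $n\to\infty$, to $\dfrac{1}{(1+\psi(x))^{\beta}}$.
   Context: All distributions are on $\mathbb{R}$; conventions $e^{-\infty}=0$, $1/\infty=0$, $\log\infty=\infty$. For $\psi:\mathbb{R}\to[0,\infty]$ such that $e^{-\psi}$ is a distribution function and $\beta>0$, the gamma-MID($\beta$) law (associated with $\psi$) has distribution function $\dfrac{1}{(1+\psi(x))^{\beta}}$ and the G-gamma-MID($\beta$) law (associated with $\psi$) has distribution function $\dfrac{1}{1+\beta\log(1+\psi(x))}$. *)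

(* Defs.v *)
From HB Require Import structures.
From mathcomp Require Import all_boot all_order all_algebra.
From mathcomp Require Import all_classical all_reals all_analysis measurable_realfun.

Set Implicit Arguments.
Unset Strict Implicit.
Unset Printing Implicit Defensive.

Import Order.TTheory GRing.Theory Num.Theory.
Import numFieldNormedType.Exports.

Local Open Scope classical_set_scope.
Local Open Scope ring_scope.

(* Distribution functions are \bar R-valued, as the library's [cdf] is; the
   four conditions force the values into [0, 1]. *)
Definition is_distribution_function (R : realType) (F : R -> \bar R) : Prop :=
  [/\ {homo F : x y / x <= y >-> (x <= y)%E},
      right_continuous F,
      F x @[x --> -oo] --> 0%E &
      F x @[x --> +oo] --> 1%E].

(* The library operations satisfy 1 + +oo = +oo, +oo `^ b = +oo for b != 0,
   lne +oo = +oo, b * +oo = +oo for 0 < b, and +oo^-1 = 0, so both functions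
   below take the value 0 where psi is infinite. *)
Definition gamma_MID_df (R : realType) (beta : R) (psi : R -> \bar R) (x : R) :
    \bar R :=
  (((1 + psi x) `^ beta)^-1)%E.

Definition G_gamma_MID_df (R : realType) (beta : R) (psi : R -> \bar R)
    (x : R) : \bar R :=
  ((1 + beta%:E * lne (1 + psi x))^-1)%E.

Definition mutually_independent (R : realType) (d : measure_display)
    (T : measurableType d) (P : probability T R) (I : finType)
    (X : I -> {RV P >-> R}) : Prop :=
  forall (J : {set I}) (A : I -> set R),
    (forall i, measurable (A i)) ->
    P (\bigcap_(i in [set` J]) (X i @^-1` A i)) =
    (\prod_(i in J) P (X i @^-1` A i))%E.

Definition iid_with_df (R : realType) (d : measure_display)
    (T : measurableType d) (P : probability T R) (I : finType)
    (X : I -> {RV P >-> R}) (F : R -> \bar R) : Prop :=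
  mutually_independent X /\ forall i, cdf (X i) =1 F.

Section max_of_random_variables.
Context (R : realType) (d : measure_display) (T : measurableType d)
  (P : probability T R) (n : nat) (X : 'I_n.+1 -> {RV P >-> R}).

(* R has no least element, so the maximum is started at the first variable. *)
Definition max_fun (w : T) : R :=
  \big[Num.max/X ord0 w]_(i < n.+1) X i w.

Lemma max_fun_measurable : measurable_fun [set: T] max_fun.
Proof.
rewrite /max_fun; elim: (index_enum _) => [|i s IH].
  by under eq_fun do rewrite big_nil; exact: measurable_funP.
under eq_fun do rewrite big_cons.
by apply: measurable_maxr => //; exact: measurable_funP.
Qed.

HB.instance Definition _ :=
  isMeasurableFun.Build _ _ _ _ max_fun max_fun_measurable.

Definition max_RV : {RV P >-> R} := max_fun.

End max_of_random_variables.

(* Main.v *)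
Require Import Defs.
From HB Require Import structures.
From mathcomp Require Import all_boot all_order all_algebra.
From mathcomp Require Import all_classical all_reals all_analysis measurable_realfun.

Import Order.TTheory GRing.Theory Num.Theory.
Import numFieldNormedType.Exports.

Local Open Scope classical_set_scope.
Local Open Scope ring_scope.

(** There are two independent facts to establish.

    The gamma-MID function is a distribution function because it is a function
    of the single number [u = e^{-psi(x)}] in [[0, 1]]: it equals
    [k(u) = (1 - ln u)^{-beta}], with [k(0) = 0] accounting for
    [psi(x) = +oo] ([gamma_MID_dfE]).  The function [k] is nondecreasing,
    continuous at each point of [[0, 1]], and satisfies [k(0) = 0] and
    [k(1) = 1], so that composing with [k] transports monotonicity,
    right-continuity and the two limits at infinity from [e^{-psi}] to
    gamma-MID.

    For the limit, independence turns the distribution function of the maximum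
    of [n] variables into the [n]-th power of the common one ([cdf_max_RV_iid]).
    Where [psi(x)] is infinite both sides are [0].  Where it is finite, put
    [c = beta * ln (1 + psi(x))]: the power is [(1 + c / n)^{-n}], which tends
    to [e^{-c} = (1 + psi(x))^{-beta}] ([cvg_expR_inv]). *)

(** * The gamma-MID function as a function of the original law *)

(** The map [k] sending the value [u = e^{-psi}] to [(1 + psi)^{-b}], written
    as an exponential.  As [ln] is [0] on nonpositive numbers, the value at
    [u <= 0] has to be set to [0] explicitly. *)
Definition mid_transform (R : realType) (b u : R) : R :=
  if 0 < u then expR (- b * ln (1 - ln u)) else 0.

Lemma mid_transform1 (R : realType) (b : R) : mid_transform R b 1 = 1.
Proof. by rewrite /mid_transform ltr01 ln1 subr0 ln1 mulr0 expR0. Qed.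

Lemma mid_transform0 (R : realType) (b : R) : mid_transform R b 0 = 0.
Proof. by rewrite /mid_transform ltxx. Qed.

Lemma subr1_ln_ge1 (R : realType) (u : R) : u <= 1 -> 1 <= 1 - ln u.
Proof. by move=> u1; rewrite lerBrDr gerDl ln_le0. Qed.

Lemma le_mid_transform (R : realType) (b u v : R) : 0 <= b -> v <= 1 ->
  u <= v -> mid_transform R b u <= mid_transform R b v.
Proof.
move=> b0 v1 uv; rewrite /mid_transform.
have [u0|_] := ltP 0 u; last by case: ifP => // _; exact: expR_ge0.
have v0 := lt_le_trans u0 uv.
have lnu := subr1_ln_ge1 _ _ (le_trans uv v1).
have lnv := subr1_ln_ge1 _ _ v1.
rewrite v0 ler_expR ler_wnM2l ?oppr_le0// ler_ln ?posrE//.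
- by rewrite lerD2l lerN2 ler_ln ?posrE.
- exact: lt_le_trans lnv.
- exact: lt_le_trans lnu.
Qed.

Lemma cvg_mid_transform0 (R : realType) (b : R) : 0 < b ->
  mid_transform R b u @[u --> 0] --> 0.
Proof.
move=> b0; apply/cvgrPdist_le => /= e e0.
(* For 0 < v < expR (1 - expR A) one has A < ln (1 - ln v), and this choice of
   A makes expR (- b * A) equal to e. *)
pose A := - ln e / b.
near=> v; rewrite sub0r normrN /mid_transform.
have [v0|_] := ltP 0 v; last by rewrite normr0 ltW.
rewrite ger0_norm ?expR_ge0//.
have lnv : expR A <= 1 - ln v.
  rewrite lerBrDr addrC -lerBrDr -ler_expR lnK ?posrE//.
  by apply: ltW; near: v; apply: lt_nbhsl; exact: expR_gt0.
rewrite -[leRHS]lnK ?posrE// ler_expR.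
have -> : ln e = - b * A.
  by rewrite /A mulrCA mulNr mulNr mulrN opprK divff ?gt_eqF// mulr1.
rewrite ler_nM2l ?oppr_lt0// -ler_expR lnK// posrE.
exact: lt_le_trans (expR_gt0 _) lnv.
Unshelve. all: by end_near. Qed.

Lemma cvg_mid_transform (R : realType) (b u : R) : 0 < b -> 0 <= u <= 1 ->
  mid_transform R b v @[v --> u] --> mid_transform R b u.
Proof.
move=> b0 /andP[]; rewrite le_eqVlt => /predU1P[<- _|u0 u1].
  by rewrite mid_transform0; exact: cvg_mid_transform0.
rewrite {2}/mid_transform u0.
have : (fun v => expR (- b * ln (1 - ln v))) v @[v --> u] -->
    expR (- b * ln (1 - ln u)).
  apply: continuous_cvg; first exact: continuous_expR.
  apply: cvgM; first exact: cvg_cst.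
  apply: continuous_cvg.
    by apply: continuous_ln; apply: lt_le_trans (subr1_ln_ge1 _ _ u1).
  by apply: cvgB; [exact: cvg_cst | exact: continuous_ln].
apply: cvg_trans; apply: near_eq_cvg; near=> v.
rewrite /mid_transform ifT//; near: v; exact: lt_nbhsr.
Unshelve. all: by end_near. Qed.

Lemma inv_poweR_1D (R : realType) (b r : R) : 0 <= r ->
  (((1 + r%:E) `^ b)^-1)%E = (expR (- (b * ln (1 + r))))%:E.
Proof.
move=> r0; have r1 : 0 < 1 + r by rewrite ltr_wpDr.
rewrite -EFinD poweR_EFin inver powR_eq0 gt_eqF//=.
by rewrite /powR gt_eqF// expRN.
Qed.

Lemma gamma_MID_dfE (R : realType) (b : R) (psi : R -> \bar R) (x : R) :
  b != 0 -> (0 <= psi x)%E ->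
  gamma_MID_df b psi x = (mid_transform R b (fine (expeR (- psi x)%E)))%:E.
Proof.
move=> b0; rewrite /gamma_MID_df; case: (psi x) => [r r0|_|//].
  by rewrite inv_poweR_1D//= /mid_transform expR_gt0 expRK opprK mulNr.
by rewrite addey// poweRyr// invey /= mid_transform0.
Qed.

Lemma expeRN_itv (R : realType) (y : \bar R) : (0 <= y)%E ->
  expeR (- y)%E \is a fin_num /\ 0 <= fine (expeR (- y)%E) <= 1.
Proof.
case: y => [r r0|_|//] /=; last by rewrite lexx ler01.
by rewrite expR_ge0 expR_le1 oppr_le0.
Qed.

Lemma cvg_gamma_MID_df (R : realType) (b : R) (psi : R -> \bar R)
    (F : set_system R) (FF : Filter F) (u : R) :
  0 < b -> (forall x, (0 <= psi x)%E) -> 0 <= u <= 1 ->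
  expeR (- psi x)%E @[x --> F] --> u%:E ->
  gamma_MID_df b psi x @[x --> F] --> (mid_transform R b u)%:E.
Proof.
move=> b0 psi0 u01 /fine_cvg psiu.
under eq_fun do rewrite gamma_MID_dfE ?gt_eqF//.
apply: cvg_EFin; first exact: nearW.
exact: (cvg_comp _ _ psiu (cvg_mid_transform R b u b0 u01)).
Qed.

Lemma gamma_MID_is_distribution_function (R : realType) (b : R)
    (psi : R -> \bar R) : 0 < b -> (forall x, (0 <= psi x)%E) ->
  is_distribution_function (fun x => expeR (- psi x)%E) ->
  is_distribution_function (gamma_MID_df b psi).
Proof.
move=> b0 psi0 [ndF rcF FNy Fy]; split.
- move=> x y xy; rewrite !gamma_MID_dfE ?gt_eqF// lee_fin.
  have [xfin _] := expeRN_itv R _ (psi0 x).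
  have [yfin /andP[_ y1]] := expeRN_itv R _ (psi0 y).
  apply: le_mid_transform => //; first exact: ltW.
  by apply: fine_le => //; exact: ndF.
- move=> x; have [xfin x01] := expeRN_itv R _ (psi0 x).
  rewrite gamma_MID_dfE ?gt_eqF//.
  by apply: cvg_gamma_MID_df => //; rewrite fineK//; exact: rcF.
- have := cvg_gamma_MID_df R b psi -oo _ 0 b0 psi0.
  by rewrite mid_transform0 lexx ler01; apply.
- have := cvg_gamma_MID_df R b psi +oo _ 1 b0 psi0.
  by rewrite mid_transform1 lexx ler01; apply.
Qed.

(** * The distribution function of the maximum *)

Lemma cdf_max_RV_iid (R : realType) (d : measure_display)
    (T : measurableType d) (P : probability T R) (n : nat)
    (X : 'I_n.+1 -> {RV P >-> R}) (F : R -> \bar R) (x : R) :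
  iid_with_df X F -> cdf (max_RV X) x = (\prod_(i < n.+1) F x)%E.
Proof.
move=> [indep XF].
have := indep [set: 'I_n.+1]%SET
  (fun=> `]-oo, x]%classic) (fun=> measurable_itv `]-oo, x]).
rewrite (eq_bigl xpredT) => [|i]; last by rewrite finset.in_setT.
rewrite (eq_bigr (fun=> F x)) => [<-|i _]; last by rewrite -(XF i).
rewrite /cdf /distribution /pushforward; congr (P _); apply/seteqP; split => w.
  rewrite /= /max_fun in_itv/= => /bigmax_leP[_ Xx] i _ /=.
  by rewrite in_itv/= Xx.
move=> Xx; rewrite /= /max_fun in_itv/=.
have Xle i : X i w <= x.
  by have := Xx i; rewrite /= in_itv /=; apply; rewrite inE.
by apply/bigmax_leP; split => // i _.
Qed.

(** * The limit of the powers *)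

(** Lower and upper bounds for the factor [(1 + t)^{-1}] that agree to first
    order in [t].  Both come from [1 + y <= expR y], at [y = t] and at
    [y = - t / (1 + t)]. *)
Lemma inv_1D_expR_bounds (R : realType) (t : R) : 0 <= t ->
  expR (- t) <= (1 + t)^-1 <= expR (- (t / (1 + t))).
Proof.
move=> t0; have t1 : 0 < 1 + t by rewrite ltr_wpDr.
apply/andP; split.
  by rewrite expRN lef_pV2 ?posrE ?expR_gt0// expR_ge1Dx.
apply: le_trans (expR_ge1Dx _).
by rewrite -[X in X - _](@divff _ (1 + t)) ?gt_eqF// -mulrBl addrK mul1r.
Qed.

Lemma cvg_expR_inv (R : realType) (c : R) : 0 <= c ->
  (1 + c / n.+1%:R)^-1 ^+ n.+1 @[n --> \oo] --> expR (- c).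
Proof.
move=> c0.
have cn0 : c / n.+1%:R @[n --> \oo] --> (0 : R).
  by rewrite -(mulr0 c); apply: cvgM; [exact: cvg_cst | exact: cvg_harmonic].
have d1 : 1 + c / n.+1%:R @[n --> \oo] --> (1 : R).
  by rewrite -[X in _ --> X](addr0 1); apply: cvgD; first exact: cvg_cst.
have tcn n : n.+1%:R * (c / n.+1%:R) = c by rewrite mulrCA divff ?mulr1.
apply: (@squeeze_cvgr _ _ _ _ (fun=> expR (- c))
  (fun n => expR (- (c / (1 + c / n.+1%:R))))).
- near=> n; have t0 : 0 <= c / n.+1%:R by rewrite divr_ge0.
  have /andP[lo hi] := inv_1D_expR_bounds _ _ t0.
  rewrite -{1}(tcn n) -mulrN expRM_natl.
  rewrite lerXn2r ?nnegrE ?expR_ge0 ?invr_ge0 ?addr_ge0//=.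
  rewrite -{2}(tcn n) -mulrA -mulrN expRM_natl.
  by rewrite lerXn2r ?nnegrE ?expR_ge0 ?invr_ge0 ?addr_ge0.
- exact: cvg_cst.
- apply: continuous_cvg; first exact: continuous_expR.
  apply: cvgN; rewrite -[X in _ --> X](mulr1 c).
  apply: cvgM; first exact: cvg_cst.
  by rewrite -[X in _ --> X]invr1; apply: cvgV d1; exact: oner_neq0.
Unshelve. all: by end_near. Qed.

Lemma cvg_G_gamma_MID_df_power (R : realType) (b : R) (psi : R -> \bar R)
    (x : R) : 0 < b -> (0 <= psi x)%E ->
  (\prod_(i < m.+1) G_gamma_MID_df (b / m.+1%:R) psi x)%E @[m --> \oo]
    --> gamma_MID_df b psi x.
Proof.
move=> b0; rewrite /G_gamma_MID_df /gamma_MID_df.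
case: (psi x) => [r r0|_|//]; last first.
  rewrite addey// poweRyr ?gt_eqF// invey.
  under eq_fun => m.
    rewrite big_ord_recl /= gt0_muley ?lte_fin ?divr_gt0// addey// invey mul0e.
    over.
  exact: cvg_cst.
have r1 : 0 < 1 + r by rewrite ltr_wpDr.
rewrite inv_poweR_1D//; set c := b * ln (1 + r).
have c0 : 0 <= c by rewrite mulr_ge0 ?ln_ge0 ?lerDl// ltW.
have powE m :
    (\prod_(i < m.+1) (1 + (b / m.+1%:R)%:E * lne (1 + r%:E))^-1)%E =
    ((1 + c / m.+1%:R)^-1 ^+ m.+1)%:E.
  have cm0 : 0 < 1 + c / m.+1%:R by rewrite ltr_wpDr// divr_ge0.
  rewrite -EFinD lne_EFin// -EFinM mulrAC -/c -EFinD inver gt_eqF// prodEFin.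
  by rewrite prodr_const card_ord.
under eq_fun do rewrite powE.
by apply: cvg_EFin; [exact: nearW | exact: cvg_expR_inv].
Qed.

(* Index m : nat stands for the sample size n = m.+1 >= 1. *)
Theorem theorem2p4 (R : realType) (beta : R) (psi : R -> \bar R)
    (beta_gt0 : 0 < beta)
    (psi_ge0 : forall x : R, (0 <= psi x)%E)
    (psi_df : is_distribution_function (fun x : R => expeR (- psi x)%E))
    (d : nat -> measure_display)
    (Omega : forall m : nat, measurableType (d m))
    (P : forall m : nat, probability (Omega m) R)
    (X : forall m : nat, 'I_m.+1 -> {RV (P m) >-> R})
    (X_iid : forall m : nat,
       iid_with_df (X m) (G_gamma_MID_df (beta / m.+1%:R) psi)) :
  is_distribution_function (gamma_MID_df beta psi) /\
  forall x : R,
    cdf (max_RV (X m)) x @[m --> \oo] --> gamma_MID_df beta psi x.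
Proof.
split; first exact: gamma_MID_is_distribution_function.
move=> x; under eq_fun do rewrite (cdf_max_RV_iid _ _ _ _ _ _ _ _ (X_iid _)).
exact: cvg_G_gamma_MID_df_power.
Qed.
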